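(* For integers $n\ge4$ and $1<m<n-1$, let $f_{m,n}:[1,n]\to[1,n]$ be the continuous map with $f_{m,n}(1)=m+1$, $f_{m,n}(j)=j-1$ for every integer $2\le j\le m$, $f_{m,n}(j)=j+1$ for every integer $m+1\le j\le n-1$, $f_{m,n}(n)=m$, and $f_{m,n}$ linear on $[j,j+1]$ for every integer $1\le j\le n-1$. Let $f:[1,4]\to[1,4]$ be the continuous map with $f(1)=f(3)=4$, $f(2)=1$, $f(4)=2$, linear on $[1,2]$, $[2,3]$ and $[3,4]$. For integers $n\ge3$ define the sequence $(a_{n,k})_{k\ge1}$ by $a_{n,k}=2^{k+1}-1$ for $1\le k\le n-1$ and $a_{n,k}=3a_{n,k-1}-\sum_{i=2}^{n-1}a_{n,k-i}$ for $k\ge n$. Then: (a) For every positive integer $k$, $a_{3,k}$ is the number of distinct fixed points of $f^k$ in $[1,4]$; and for every positive integer $k$ and all integers $n\ge4$, $1<m<n-1$, the number of distinct fixed points of $f_{m,n}^k$ in $[1,n]$ is $a_{n,k}$ (in particular independent of $m$). Consequently, for every integer $n\ge3$, setting $\phi_{a_n}(k)=a_{n,k}$, we have $\Phi_1(k,\phi_{a_n})\equiv0\pmod k$ for all integers $k\ge1$. (b) For every integer $n\ge3$, the generating function $G_{a_n}(z)=\sum_{k\ge1}a_{n,k}z^k$ equals $$G_{a_n}(z)=\frac{3z-\sum_{k=2}^{n-1}kz^k}{1-3z+\sum_{k=2}^{n-1}z^k}.$$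
   Context: $f^k$ denotes the $k$-th iterate of $f$. For an integer-valued function $\phi$ on the positive integers: $\Phi_1(1,\phi)=\phi(1)$, and if $m=p_1^{k_1}\cdots p_r^{k_r}$ with $p_1,\dots,p_r$ distinct primes and $r,k_i\ge1$, then $\Phi_1(m,\phi)=\sum_{T\subseteq\{1,\dots,r\}}(-1)^{|T|}\phi\big(m/\prod_{i\in T}p_i\big)$ (empty product $=1$). *)

(* Defs.v *)
From HB Require Import structures.
From mathcomp Require Import all_boot all_order all_algebra.
From mathcomp Require Import all_classical all_reals all_analysis.
From mathcomp Require Import zify ring lra.

Set Implicit Arguments.
Unset Strict Implicit.
Unset Printing Implicit Defensive.

Import Order.TTheory GRing.Theory Num.Theory.
Import numFieldNormedType.Exports.

Local Open Scope classical_set_scope.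
Local Open Scope ring_scope.

(* [:: u (k-1); ...; u 0], where u k = F [:: u (k-1); ...; u 0] *)
Fixpoint history (T : Type) (F : seq T -> T) (k : nat) : seq T :=
  if k is k'.+1 then F (history F k') :: history F k' else [::].

Definition cov_rec (T : Type) (F : seq T -> T) (k : nat) : T := F (history F k).

Lemma size_history (T : Type) (F : seq T -> T) k : size (history F k) = k.
Proof. by elim: k => //= k ->. Qed.

Lemma nth_history (T : Type) (F : seq T -> T) x0 k i : (i < k)%N ->
  nth x0 (history F k) i = cov_rec F (k - i.+1).
Proof.
by elim: k i => //= k IHk [_|i ik] /=; [rewrite subn1 | rewrite IHk // subSS].
Qed.

(* The value at k = 0 is irrelevant: no term of positive index uses it. *)
Definition a_step (n : nat) (s : seq int) : int :=
  if (size s < n)%N then 2 ^+ (size s).+1 - 1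
  else 3 * s`_0 - \sum_(2 <= i < n) s`_i.-1.

Definition a (n k : nat) : int := cov_rec (a_step n) k.

Lemma a_init n k : (1 <= k <= n.-1)%N -> a n k = 2 ^+ k.+1 - 1.
Proof.
move=> hk; rewrite /a /cov_rec /a_step size_history.
by have -> : (k < n)%N by lia.
Qed.

Lemma a_recurrence n k : (3 <= n)%N -> (n <= k)%N ->
  a n k = 3 * a n k.-1 - \sum_(2 <= i < n) a n (k - i).
Proof.
move=> n3 nk; rewrite /a {1}/cov_rec {1}/a_step size_history ltnNge nk /=.
rewrite nth_history ?subn1; last by lia.
congr (_ - _); apply: eq_big_nat => i hi.
by rewrite nth_history; [congr (cov_rec _ _)|]; lia.
Qed.

(* [primes m] lists the distinct primes p_1, ..., p_r dividing m; it is empty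
   for m = 1, and the sum is then phi 1. *)
Definition Phi1 (m : nat) (phi : nat -> int) : int :=
  \sum_(T : {set 'I_(size (primes m))})
    (-1) ^+ #|T| * phi (m %/ \prod_(i in T) nth 1%N (primes m) i)%N.

Lemma Phi1_1 phi : Phi1 1 phi = phi 1%N.
Proof.
rewrite /Phi1 (big_pred1 (finset.set0 : {set 'I_(size (primes 1))})).
  by rewrite cards0 expr0 mul1r big_set0.
by move=> T /=; apply/esym/eqP/setP => -[].
Qed.

Record fps (R : Type) := Fps { fcoef : nat -> R }.

Lemma fpsP (R : Type) (f g : fps R) : fcoef f =1 fcoef g <-> f = g.
Proof. by split=> [|-> //]; case: f g => [f] [g] /= /funext ->. Qed.

HB.instance Definition _ (R : Type) := gen_eqMixin (fps R).
HB.instance Definition _ (R : Type) := gen_choiceMixin (fps R).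

Section FpsZmod.
Variable R : zmodType.
Implicit Types f g h : fps R.

Definition fps_zero : fps R := Fps (fun=> 0).
Definition fps_add f g : fps R := Fps (fun k => fcoef f k + fcoef g k).
Definition fps_opp f : fps R := Fps (fun k => - fcoef f k).

Lemma fps_addA : associative fps_add.
Proof. by move=> f g h; apply/fpsP => k /=; rewrite addrA. Qed.
Lemma fps_addC : commutative fps_add.
Proof. by move=> f g; apply/fpsP => k /=; rewrite addrC. Qed.
Lemma fps_add0 : left_id fps_zero fps_add.
Proof. by move=> f; apply/fpsP => k /=; rewrite add0r. Qed.
Lemma fps_addN : left_inverse fps_zero fps_opp fps_add.
Proof. by move=> f; apply/fpsP => k /=; rewrite addNr. Qed.

HB.instance Definition _ := GRing.isZmodule.Build (fps R)
  fps_addA fps_addC fps_add0 fps_addN.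
End FpsZmod.

Section FpsRing.
Variable R : comNzRingType.
Implicit Types f g h : fps R.

Definition fps_one : fps R := Fps (fun k => (k == 0%N)%:R).
Definition fps_mul f g : fps R :=
  Fps (fun k => \sum_(i < k.+1) fcoef f i * fcoef g (k - i)%N).

Lemma fcoefM f g k : fcoef (fps_mul f g) k =
  \sum_(i < k.+1) fcoef f i * fcoef g (k - i)%N.
Proof. by []. Qed.

Let trunc k f : {poly R} := \poly_(i < k.+1) fcoef f i.

Let fcoef_mul f g k i : (i <= k)%N ->
  fcoef (fps_mul f g) i = (trunc k f * trunc k g)`_i.
Proof.
move=> ik; rewrite coefM /=; apply: eq_bigr => j _.
have jk : (j < k.+1)%N by apply: leq_trans (ltn_ord j) _.
have ijk : (i - j < k.+1)%N by rewrite ltnS (leq_trans (leq_subr _ _)).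
by rewrite !coef_poly jk ijk.
Qed.

Lemma fps_mulC : commutative fps_mul.
Proof. by move=> f g; apply/fpsP => k; rewrite !(@fcoef_mul _ _ k)// mulrC. Qed.

Lemma fps_mulA : associative fps_mul.
Proof.
move=> f g h; apply/fpsP => k; transitivity (trunc k f * trunc k g * trunc k h)`_k.
  rewrite -mulrA coefM fcoefM; apply: eq_bigr => i _.
  by rewrite -(@fcoef_mul _ _ k) ?leq_subr// coef_poly ltn_ord.
rewrite coefM fcoefM; apply: eq_bigr => i _.
have ik : (i <= k)%N by rewrite -ltnS.
by rewrite -(@fcoef_mul _ _ k)// coef_poly ltnS leq_subr.
Qed.

Lemma fps_mul1 : left_id fps_one fps_mul.
Proof.
move=> f; apply/fpsP => k /=; rewrite big_ord_recl /= mul1r subn0 big1 ?addr0//.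
by move=> i _; rewrite mul0r.
Qed.

Lemma fps_mulDl : left_distributive fps_mul (@fps_add R).
Proof.
move=> f g h; apply/fpsP => k /=; rewrite -big_split /=.
by apply: eq_bigr => i _; rewrite mulrDl.
Qed.

Lemma fps_one_neq0 : fps_one != 0.
Proof.
by apply/eqP => /fpsP /(_ 0%N) /= /eqP; rewrite oner_eq0.
Qed.

HB.instance Definition _ := GRing.Zmodule_isComNzRing.Build (fps R)
  fps_mulA fps_mulC fps_mul1 fps_mulDl fps_one_neq0.

Definition fps_X : fps R := Fps (fun k => (k == 1%N)%:R).

End FpsRing.
Arguments fps_X {R}.

Section FpsUnitRing.
Variable R : comUnitRingType.
Implicit Types f g h : fps R.

Definition fps_unit : {pred fps R} := [pred f | fcoef f 0 \is a GRing.unit].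

Definition fps_inv_step f (s : seq R) : R :=
  (fcoef f 0)^-1 *
  ((size s == 0%N)%:R - \sum_(i < size s) fcoef f i.+1 * s`_i).

Definition fps_inv f : fps R :=
  if f \in fps_unit then Fps (cov_rec (fps_inv_step f)) else f.

Lemma fps_mulV : {in fps_unit, left_inverse 1 fps_inv *%R}.
Proof.
move=> f fU; rewrite mulrC /fps_inv fU; apply/fpsP => k /=.
rewrite big_ord_recl /= subn0 {1}/cov_rec {1}/fps_inv_step mulVKr//.
rewrite size_history -[RHS](subrK (\sum_(i < k) fcoef f i.+1 *
  (history (fps_inv_step f) k)`_i)); congr (_ + _).
by apply: eq_bigr => i _; rewrite nth_history.
Qed.

Lemma fps_unitP f g : g * f = 1 -> f \in fps_unit.
Proof.
move=> /fpsP /(_ 0%N) /=; rewrite big_ord_recl big_ord0 /= addr0 => gf1.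
by apply/unitrPr; exists (fcoef g 0); rewrite mulrC.
Qed.

Lemma fps_inv_out : {in [predC fps_unit], fps_inv =1 id}.
Proof. by move=> f; rewrite /fps_inv inE => /negbTE ->. Qed.

HB.instance Definition _ := GRing.ComNzRing_hasMulInverse.Build (fps R)
  fps_mulV fps_unitP fps_inv_out.

End FpsUnitRing.

Definition gen_fun (n : nat) : fps int :=
  Fps (fun k => if (1 <= k)%N then a n k else 0).

Definition gen_num (n : nat) : fps int :=
  3 * fps_X - \sum_(2 <= k < n) k%:R * fps_X ^+ k.

Definition gen_den (n : nat) : fps int :=
  1 - 3 * fps_X + \sum_(2 <= k < n) fps_X ^+ k.

Lemma gen_den_unit n : gen_den n \is a GRing.unit.
Proof.
have X0 k : (0 < k)%N -> fcoef ((fps_X : fps int) ^+ k) 0 = 0.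
  by case: k => // k _; rewrite exprS /= big_ord_recl big_ord0 /= mul0r addr0.
change (fcoef (gen_den n) 0 \is a GRing.unit).
have -> : fcoef (gen_den n) 0 = 1; last exact: unitr1.
rewrite /gen_den /= big_ord_recl big_ord0 /= mulr0 addr0.
suff -> : fcoef (\sum_(2 <= k < n) (fps_X : fps int) ^+ k) 0 = 0 by rewrite addr0.
rewrite big_nat; elim/big_ind: _ => //= [f g -> -> //|k hk].
by rewrite X0//; lia.
Qed.

Section Maps.
Variable R : realType.
Implicit Types f : R -> R.

Definition linear_on (x y : R) f :=
  exists c d : R, forall t, x <= t <= y -> f t = c * t + d.

(* Only the restriction of f to [1, n] matters. *)
Record is_fmn (m n : nat) f : Prop := IsFmn {
  fmn_maps : forall x, 1 <= x <= n%:R -> 1 <= f x <= n%:R;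
  fmn_cont : {within `[1, n%:R], continuous f};
  fmn_1 : f 1 = m.+1%:R;
  fmn_low : forall j : nat, (2 <= j <= m)%N -> f j%:R = j.-1%:R;
  fmn_high : forall j : nat, (m.+1 <= j <= n.-1)%N -> f j%:R = j.+1%:R;
  fmn_n : f n%:R = m%:R;
  fmn_lin : forall j : nat, (1 <= j <= n.-1)%N -> linear_on j%:R j.+1%:R f
}.

Record is_f4 f : Prop := IsF4 {
  f4_maps : forall x, 1 <= x <= 4 -> 1 <= f x <= 4;
  f4_cont : {within `[1, 4], continuous f};
  f4_1 : f 1 = 4;
  f4_2 : f 2 = 1;
  f4_3 : f 3 = 4;
  f4_4 : f 4 = 2;
  f4_lin12 : linear_on 1 2 f;
  f4_lin23 : linear_on 2 3 f;
  f4_lin34 : linear_on 3 4 f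
}.

Definition fixed_points f (k n : nat) : set R :=
  [set x | 1 <= x <= n%:R /\ iter k f x = x].

Definition has_card (A : set R) (z : int) :=
  exists2 N : nat, (A #= `I_N)%card & z = N%:Z.

Definition clamp (x : R) : R := Num.min (Num.max x 0) 1.

Definition interp (v : nat -> nat) (n : nat) (x : R) : R :=
  (v 1%N)%:R +
  \sum_(1 <= i < n) ((v i.+1)%:R - (v i)%:R) * clamp (x - i%:R).

Lemma interpE v n (j : nat) x : (1 <= j < n)%N -> j%:R <= x <= j.+1%:R ->
  interp v n x = (v j)%:R + ((v j.+1)%:R - (v j)%:R) * (x - j%:R).
Proof.
move=> /andP[j1 jn] /andP[jx xj]; rewrite /interp.
rewrite (big_cat_nat (n := j)) //=; last by lia.
rewrite [X in _ + (_ + X)]big_ltn //.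
have -> : \sum_(j.+1 <= i < n) ((v i.+1)%:R - (v i)%:R) * clamp (x - i%:R) = 0.
  rewrite big_nat; apply: big1 => i /andP[ij _].
  have h : j.+1%:R <= i%:R :> R by rewrite ler_nat.
  rewrite /clamp max_r; last by lra.
  by rewrite min_l ?mulr0 ?ler01.
have -> : \sum_(1 <= i < j) ((v i.+1)%:R - (v i)%:R) * clamp (x - i%:R) =
    (v j)%:R - (v 1%N)%:R.
  rewrite -(telescope_sumr (fun i => (v i)%:R : R)) //; apply: eq_big_nat => i.
  move=> /andP[_ ij]; have h : i.+1%:R <= j%:R :> R by rewrite ler_nat.
  rewrite /clamp min_r ?mulr1 // le_max; apply/orP; left.
  by move: h; rewrite -natr1; lra.
have -> : clamp (x - j%:R) = x - j%:R.
  move: xj; rewrite -natr1 => xj.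
  by rewrite /clamp max_l ?min_l //; lra.
by ring.
Qed.

Lemma interp_nat v n (j : nat) : (1 < n)%N -> (1 <= j <= n)%N ->
  interp v n j%:R = (v j)%:R.
Proof.
move=> n1 jn; have [jln|] := ltnP j n.
  rewrite (@interpE _ _ j) ?subrr ?mulr0 ?addr0 ?lexx ?ler_nat ?leqnSn //.
  by lia.
move=> nj; have -> : j = j.-1.+1 by lia.
rewrite (@interpE _ _ j.-1) ?lexx ?ler_nat ?leqnSn //; last by lia.
by rewrite -natr1; ring.
Qed.

Lemma interp_continuous v n : continuous (interp v n).
Proof.
move=> x; apply: cvgD; first exact: cvg_cst.
apply: cvg_big => [|i _]; first exact: add_continuous.
apply: cvgM; first exact: cvg_cst.
have cB : {for x, continuous (fun y : R => y - i%:R)}.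
  by apply: cvgB; [exact: cvg_id | exact: cvg_cst].
have cM := continuous_max cB (@cst_continuous R R 0 x).
exact: (continuous_min cM (@cst_continuous R R 1 x)).
Qed.

Lemma cell (n : nat) (x : R) : (1 < n)%N -> 1 <= x <= n%:R ->
  exists2 j : nat, (1 <= j < n)%N & j%:R <= x <= j.+1%:R.
Proof.
case: n => // -[//|n] _; elim: n => [|n IHn] /andP[x1 xn].
  by exists 1%N => //; rewrite x1.
have [xle|xgt] := leP x n.+2%:R.
  by have [|j jn jx] := IHn; [rewrite x1 | exists j => //; lia].
by exists n.+2; [lia | rewrite ltW].
Qed.

Lemma interp_maps v n : (1 < n)%N ->
  (forall j, (1 <= j <= n)%N -> (1 <= v j <= n)%N) ->
  forall x, 1 <= x <= n%:R -> 1 <= interp v n x <= n%:R.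
Proof.
move=> n1 hv x hx; have [j jn jx] := cell n1 hx.
rewrite (interpE _ jn jx).
have /hv : (1 <= j <= n)%N by lia.
have /hv : (1 <= j.+1 <= n)%N by lia.
rewrite -!(ler_nat R) => /andP[? ?] /andP[? ?].
move: jx; rewrite -natr1 => /andP[? ?]; nra.
Qed.

Lemma interp_linear v n j : (1 <= j < n)%N -> linear_on j%:R j.+1%:R (interp v n).
Proof.
move=> jn; exists ((v j.+1)%:R - (v j)%:R).
exists ((v j)%:R - ((v j.+1)%:R - (v j)%:R) * j%:R) => t ht.
by rewrite (interpE _ jn ht); ring.
Qed.

Lemma is_fmn_exists m n : (4 <= n)%N -> (1 < m < n.-1)%N ->
  exists f, is_fmn m n f.
Proof.
move=> n4 hm.
pose v j := if (j <= 1)%N then m.+1 else if (j <= m)%N then j.-1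
            else if (j < n)%N then j.+1 else m.
have n1 : (1 < n)%N by lia.
exists (interp v n); split.
- by apply: interp_maps => // j; rewrite /v; do ![case: ifP]; lia.
- exact/continuous_subspaceT/interp_continuous.
- by rewrite -[1 in LHS]/(1%:R) interp_nat//; lia.
- move=> j hj; rewrite interp_nat//; last by lia.
  by rewrite /v; do ![case: ifP] => //; lia.
- move=> j hj; rewrite interp_nat//; last by lia.
  by rewrite /v; do ![case: ifP] => //; lia.
- rewrite interp_nat//; last by lia.
  by rewrite /v; do ![case: ifP] => //; lia.
- by move=> j hj; apply: interp_linear; lia.
Qed.

Lemma is_f4_exists : exists f, is_f4 f.
Proof.
pose v j := nth 0%N [:: 0; 4; 1; 4; 2]%N j.
exists (interp v 4); split.
- by apply: interp_maps => // -[|[|[|[|[|]]]]].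
- exact/continuous_subspaceT/interp_continuous.
- exact: (@interp_nat v 4 1).
- exact: (@interp_nat v 4 2).
- exact: (@interp_nat v 4 3).
- exact: (@interp_nat v 4 4).
- exact: (@interp_linear v 4 1).
- exact: (@interp_linear v 4 2).
- exact: (@interp_linear v 4 3).
Qed.

Lemma linear_on_eq (x y : R) f g : x < y -> linear_on x y f -> linear_on x y g ->
  f x = g x -> f y = g y -> forall t, x <= t <= y -> f t = g t.
Proof.
move=> xy [c [d fE]] [c' [d' gE]] fgx fgy t ht.
have hx : x <= x <= y by lra.
have hy : x <= y <= y by lra.
move: fgx fgy; rewrite !fE ?gE // => ex ey.
have : (c - c') * (y - x) = 0 by lra.
move=> /eqP; rewrite mulf_eq0 => /orP[] /eqP h; last by lra.
have cc : c = c' by lra.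
by subst c'; lra.
Qed.

Lemma is_fmn_unique m n f g : (4 <= n)%N -> (1 < m < n.-1)%N ->
  is_fmn m n f -> is_fmn m n g -> forall x, 1 <= x <= n%:R -> f x = g x.
Proof.
move=> n4 hm hf hg x hx; have n1 : (1 < n)%N by lia.
have fgj (j : nat) : (1 <= j <= n)%N -> f j%:R = g j%:R.
  move=> hj; have [->|j1] := eqVneq j 1%N; first by rewrite (fmn_1 hf) (fmn_1 hg).
  have [->|jn] := eqVneq j n; first by rewrite (fmn_n hf) (fmn_n hg).
  have [jm|mj] := leqP j m.
    by rewrite (fmn_low hf) ?(fmn_low hg) //; lia.
  by rewrite (fmn_high hf) ?(fmn_high hg) //; lia.
have [j jn jx] := cell n1 hx.
apply: (@linear_on_eq j%:R j.+1%:R) => //; rewrite ?ltr_nat //.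
- by apply: (fmn_lin hf); lia.
- by apply: (fmn_lin hg); lia.
- by apply: fgj; lia.
- by apply: fgj; lia.
Qed.

Lemma is_f4_unique f g : is_f4 f -> is_f4 g ->
  forall x, 1 <= x <= 4 -> f x = g x.
Proof.
move=> hf hg x /andP[x1 x4].
have e1 : f 1 = g 1 by rewrite (f4_1 hf) (f4_1 hg).
have e2 : f 2 = g 2 by rewrite (f4_2 hf) (f4_2 hg).
have e3 : f 3 = g 3 by rewrite (f4_3 hf) (f4_3 hg).
have e4 : f 4 = g 4 by rewrite (f4_4 hf) (f4_4 hg).
have [x2|x2] := leP x 2.
  by apply: (linear_on_eq _ (f4_lin12 hf) (f4_lin12 hg)) => //; lra.
have [x3|x3] := leP x 3.
  by apply: (linear_on_eq _ (f4_lin23 hf) (f4_lin23 hg)) => //; lra.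
by apply: (linear_on_eq _ (f4_lin34 hf) (f4_lin34 hg)) => //; lra.
Qed.

End Maps.

(* Main.v *)
Require Import Defs.
From mathcomp Require Import all_boot all_order all_algebra.
From mathcomp Require Import all_classical all_reals all_analysis.
From mathcomp Require Import unstable finmap zify ring lra.

Set Implicit Arguments.
Unset Strict Implicit.
Unset Printing Implicit Defensive.

Import Order.TTheory GRing.Theory Num.Theory.

Local Open Scope ring_scope.

(* The maps are piecewise linear and Markov for the partition of [1, n] into unit cells.
   The inverse branches along a closed walk of length k in the covering graph compose to
   an affine contraction, so exactly one fixed point of f^k follows that walk.  Conversely
   a fixed point of f^k follows exactly one closed walk: only integer points lie in two
   cells, and their orbits pass through 1 or n, which lie in one cell.  So the number of
   fixed points is tr(A^k), A being the adjacency matrix of the covering graph.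

   For f_{m,n}, let D be the difference operator on functions of the n integer points.
   Then A D = D B, where B is the matrix of a cyclic permutation of the points, with sign
   -1 and a loop of weight 2 added at 1 and n.  Going once around the cycle shows that
   B^(n-2) (B - 2)^2 = 1, i.e. (B - 1) p(B) = 0 for
   p = X^(n-1) - 3 X^(n-2) + X^(n-3) + ... + 1.  The vectors fixed by B are the constants,
   which D kills, so p(A) = 0: this is the recurrence.  As a walk of length k < n cannot
   go around the cycle, tr(A^k) = tr(B^k) - 1 = 2 * 2^k - 1 for 0 < k < n.

   The congruence holds because Phi_1(k, .) turns the number of fixed points of f^d into
   the number of points of least period k, which split into orbits of size k. *)

(** * The generating function *)

Lemma fcoefD (V : zmodType) (g h : fps V) k : fcoef (g + h) k = fcoef g k + fcoef h k.
Proof. by []. Qed.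

Lemma fcoefN (V : zmodType) (g : fps V) k : fcoef (- g) k = - fcoef g k.
Proof. by []. Qed.

Lemma fcoef_sum (V : zmodType) I (r : seq I) (P : pred I) (F : I -> fps V) k :
  fcoef (\sum_(i <- r | P i) F i) k = \sum_(i <- r | P i) fcoef (F i) k.
Proof. exact: (big_morph (fun g => fcoef g k)). Qed.

Lemma fcoefMn (V : zmodType) (g : fps V) j k : fcoef (g *+ j) k = fcoef g k *+ j.
Proof. by elim: j => [//|j IHj]; rewrite !mulrS fcoefD IHj. Qed.

Lemma fcoefXM (S : comNzRingType) (g : fps S) k :
  fcoef (fps_X * g) k = if k is k'.+1 then fcoef g k' else 0.
Proof.
case: k => [|k]; rewrite fcoefM /=.
  by rewrite big_ord_recl big_ord0 /= mul0r addr0.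
rewrite big_ord_recl /= mul0r add0r big_ord_recl /= mul1r subSS subn0 big1 ?addr0 //.
by move=> i _; rewrite mul0r.
Qed.

Lemma fcoefXnM (S : comNzRingType) (g : fps S) i k :
  fcoef (fps_X ^+ i * g) k = if (i <= k)%N then fcoef g (k - i) else 0.
Proof.
elim: i k => [|i IHi] k; first by rewrite expr0 mul1r subn0.
by rewrite exprS -mulrA fcoefXM; case: k => // k; rewrite IHi.
Qed.

Lemma fcoefXn (S : comNzRingType) i k : fcoef ((fps_X : fps S) ^+ i) k = (k == i)%:R.
Proof.
rewrite -[fps_X ^+ i]mulr1 fcoefXnM /=.
have [ik|ki] := leqP i k; last by have -> : (k == i) = false by lia.
by congr (_%:R); lia.
Qed.

Lemma fcoef_gen_denM n (g : fps int) k : fcoef (gen_den n * g) k =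
  fcoef g k - (if k is k'.+1 then fcoef g k' else 0) *+ 3 +
  \sum_(2 <= i < n | (i <= k)%N) fcoef g (k - i).
Proof.
rewrite /gen_den mulr_natl !mulrDl mulNr mulrnAl mul1r mulr_suml.
rewrite !(fcoefD, fcoefN, fcoefMn, fcoef_sum) fcoefXM [in RHS]big_mkcond.
by congr (_ + _); apply: eq_bigr => i _; rewrite fcoefXnM.
Qed.

Lemma fcoef_gen_num n k :
  fcoef (gen_num n) k = (k == 1%N)%:R *+ 3 - (if (2 <= k < n)%N then k%:R else 0).
Proof.
rewrite /gen_num mulr_natl fcoefD fcoefN fcoefMn fcoef_sum; congr (_ - _).
under eq_bigr do rewrite mulr_natl fcoefMn fcoefXn eq_sym mulrnAC mulrb.
by rewrite -big_mkcond big_nat1_eq.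
Qed.

Lemma sum_pow2_sub1 k :
  \sum_(1 <= i < k.+1) ((2 : int) ^+ i.+1 - 1) = 2 ^+ k.+2 - 4 - k%:R.
Proof.
elim: k => [|k IHk]; first by rewrite big_geq.
by rewrite big_nat_recr //= IHk -!natr1 !exprS; ring.
Qed.

Lemma a_init_recurrence n k : (1 < k < n)%N ->
  a n k = 3 * a n k.-1 - \sum_(2 <= i < k) a n (k - i) - k%:R.
Proof.
case: k => [|[|k]] // kn.
have -> : \sum_(2 <= i < k.+2) a n (k.+2 - i) = \sum_(1 <= i < k.+1) (2 ^+ i.+1 - 1).
  rewrite big_add1 [RHS]big_nat_rev /=; apply: eq_big_nat => i ik.
  by rewrite a_init; [congr (2 ^+ _ - 1)|]; lia.
rewrite sum_pow2_sub1 !a_init; [|lia|lia].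
by rewrite -!natr1 !exprS; ring.
Qed.

Lemma gen_den_mul_gen_fun n : (3 <= n)%N -> gen_den n * gen_fun n = gen_num n.
Proof.
move=> n3; apply/fpsP => k; rewrite fcoef_gen_denM fcoef_gen_num.
case: k => [|[|k]].
- by rewrite big_nat_cond big1 => [//|i]; lia.
- rewrite big_nat_cond big1 => [|i]; last by lia.
  by rewrite /= a_init; [|lia].
have [kn|nk] := ltnP k.+2 n.
  have -> : \sum_(2 <= i < n | (i <= k.+2)%N) fcoef (gen_fun n) (k.+2 - i) =
      \sum_(2 <= i < k.+2) a n (k.+2 - i).
    rewrite -(big_nat_widen 2 k.+3 n xpredT) // big_nat_recr //= subnn addr0.
    by apply: eq_big_nat => i ik; rewrite ifT //; lia.
  by rewrite /= a_init_recurrence //=; ring.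
have -> : \sum_(2 <= i < n | (i <= k.+2)%N) fcoef (gen_fun n) (k.+2 - i) =
    \sum_(2 <= i < n) a n (k.+2 - i).
  rewrite big_nat_cond [RHS]big_nat; apply: eq_big => i /=; first by lia.
  by move=> ik; rewrite ifT //; lia.
by rewrite /= a_recurrence //=; ring.
Qed.

Lemma a_unique n (u : nat -> int) : (3 <= n)%N ->
  (forall k, (0 < k < n)%N -> u k = 2 ^+ k.+1 - 1) ->
  (forall k, (n <= k)%N -> u k = 3 * u k.-1 - \sum_(2 <= i < n) u (k - i)%N) ->
  forall k, (0 < k)%N -> u k = a n k.
Proof.
move=> n3 u_init u_rec; elim/ltn_ind => k IHk k_gt0.
have [kn|nk] := ltnP k n; first by rewrite u_init ?a_init //; lia.
rewrite u_rec // a_recurrence // IHk; [|lia|lia].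
by congr (_ - _); apply: eq_big_nat => i i_n; apply: IHk; lia.
Qed.

(** * The congruence *)

Definition primes_subprod (k : nat) (S : {set 'I_(size (primes k))}) : nat :=
  \prod_(i in S) nth 1%N (primes k) i.

Lemma prime_nth_primes k (i : 'I_(size (primes k))) :
  prime (nth 1%N (primes k) i) && (nth 1%N (primes k) i %| k)%N.
Proof.
by have := mem_nth 1%N (ltn_ord i); rewrite mem_primes => /and3P[-> _ ->].
Qed.

Lemma primes_subprod_dvdn k (S : {set 'I_(size (primes k))}) q :
  (primes_subprod S %| q)%N = [forall i in S, nth 1%N (primes k) i %| q]%N.
Proof.
have primes_coprime : pairwise coprime
    [seq nth 1%N (primes k) i | i : 'I_(size (primes k)) <- index_enum _ & i \in S].
  rewrite pairwise_map; have /(filter_uniq (mem S)) := index_enum_uniq 'I_(size (primes k)).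
  rewrite uniq_pairwise; apply: sub_pairwise => i j ij /=.
  have /andP[pi _] := prime_nth_primes i; have /andP[pj _] := prime_nth_primes j.
  by rewrite prime_coprime ?dvdn_prime2 ?nth_uniq ?primes_uniq.
apply/(Gauss_dvd_prod q primes_coprime)/forall_inP => dvd_q i; last by move=> _ /dvd_q.
by apply: dvd_q; rewrite mem_index_enum.
Qed.

Lemma primes_subprod_dvd k (S : {set 'I_(size (primes k))}) : (primes_subprod S %| k)%N.
Proof.
by rewrite primes_subprod_dvdn; apply/forall_inP => i _; have /andP[] := prime_nth_primes i.
Qed.

Lemma sum_sign_primes_subprod_dvdn k q :
  \sum_(S : {set 'I_(size (primes k))}) (-1) ^+ #|S| * (primes_subprod S %| q)%N%:R =
  \prod_(i < size (primes k)) (1 - (nth 1 (primes k) i %| q)%N%:R) :> int.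
Proof.
under [RHS]eq_bigr do rewrite addrC.
rewrite bigA_distr; apply: eq_bigr => S _.
rewrite -big_mkcond /= prodrN; congr (_ * _).
rewrite primes_subprod_dvdn; case: forallP => [dvd_q|/forallP].
  by rewrite big1 // => i iS; have := dvd_q i; rewrite iS /= => ->.
rewrite negb_forall => /existsP[i]; rewrite negb_imply => /andP[iS /negbTE ni].
by rewrite (bigD1 i) //= ni mul0r.
Qed.

Lemma prod_primes_sub_dvdn k q : (0 < k)%N -> (q %| k)%N ->
  \prod_(i < size (primes k)) (1 - (nth 1 (primes k) i %| q)%N%:R) = (q == 1%N)%:R :> int.
Proof.
move=> k_gt0 qk; have [->|q1] := eqVneq q 1%N.
  apply: big1 => i _; have /andP[/prime_gt1 p1 _] := prime_nth_primes i.
  by rewrite dvdn1 gtn_eqF ?subr0.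
have q_pdiv : pdiv q \in primes k.
  rewrite mem_primes k_gt0 pdiv_prime ?(dvdn_trans (pdiv_dvd _)) //=.
  by have := dvdn_gt0 k_gt0 qk; lia.
move: (q_pdiv); rewrite -index_mem => pdiv_idx.
by rewrite (bigD1 (Ordinal pdiv_idx)) //= nth_index // pdiv_dvd subrr mul0r.
Qed.

Lemma Phi1_dvdn m k : (0 < k)%N -> Phi1 k (fun d => (m %| d)%N%:R) = (m == k)%:R.
Proof.
move=> k_gt0; have dvd_sub S := dvdn_div (@primes_subprod_dvd k S).
have [mk|Nmk] := boolP (m %| k)%N; last first.
  rewrite /Phi1 big1 => [|S _].
    by case: eqVneq Nmk => [->|//]; rewrite dvdnn.
  have /negbTE -> : ~~ (m %| k %/ primes_subprod S)%N; last by rewrite mulr0.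
  by apply: contra Nmk => /dvdn_trans; apply; exact: dvd_sub.
transitivity (\sum_(S : {set 'I_(size (primes k))})
    (-1) ^+ #|S| * (primes_subprod S %| k %/ m)%N%:R : int).
  apply: eq_bigr => S _; congr (_ * _%:R).
  by rewrite dvdn_divRL ?primes_subprod_dvd // mulnC -dvdn_divRL.
rewrite sum_sign_primes_subprod_dvdn prod_primes_sub_dvdn ?dvdn_div //.
congr (_%:R); rewrite -(eqn_pmul2r (dvdn_gt0 k_gt0 mk)) divnK // mul1n.
by rewrite eq_sym.
Qed.

Lemma Phi1_sum (I : finType) (phi : I -> nat -> int) k :
  Phi1 k (fun d => \sum_x phi x d) = \sum_x Phi1 k (phi x).
Proof. by rewrite exchange_big; apply: eq_bigr => S _; rewrite big_distrr. Qed.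

Lemma eq_Phi1 k phi psi : {in [pred d | (d %| k)%N], phi =1 psi} -> Phi1 k phi = Phi1 k psi.
Proof.
move=> phi_psi; apply: eq_bigr => S _; congr (_ * _); apply: phi_psi.
by rewrite inE dvdn_div // primes_subprod_dvd.
Qed.

Lemma iter_eq_dvdn_order (T : finType) (f : T -> T) (x : T) d : injective f ->
  (iter d f x == x) = (order f x %| d)%N.
Proof.
move=> f_inj; have iter_mul_order c : iter (c * order f x) f x = x.
  by elim: c => [//|c IHc]; rewrite mulSn iterD IHc; apply: iter_order.
rewrite {1}(divn_eq d (order f x)) addnC iterD iter_mul_order /dvdn.
have /findex_iter : (d %% order f x < order f x)%N by rewrite ltn_mod order_gt0.
by move=> {2}<-; rewrite findex_eq0 eq_sym.
Qed.

Lemma Phi1_card_iter_fixed (T : finType) (f : T -> T) k : injective f -> (0 < k)%N ->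
  (Phi1 k (fun d => #|[pred x | iter d f x == x]|%:Z) = 0 %[mod k%:Z])%Z.
Proof.
move=> f_inj k_gt0.
have sum_bool (P : pred T) : #|P|%:Z = \sum_x (P x)%:R.
  rewrite -sum1_card -natz natr_sum big_mkcond; apply: eq_bigr => x _.
  by rewrite unfold_in; case: (P x).
have -> : Phi1 k (fun d => #|[pred x | iter d f x == x]|%:Z) =
    #|[pred x | order f x == k]|%:Z.
  rewrite (@eq_Phi1 _ _ (fun d => \sum_x (order f x %| d)%N%:R)); last first.
    by move=> d _; rewrite sum_bool; apply: eq_bigr => x _; rewrite /= iter_eq_dvdn_order.
  rewrite (Phi1_sum (fun x d => (order f x %| d)%N%:R)) sum_bool.
  by apply: eq_bigr => x _; apply: Phi1_dvdn.
have <- : (fcard f [pred x | order f x == k] * k)%N = #|[pred x | order f x == k]|.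
  apply: (fcard_order_set f_inj); first by apply/fintype.subsetP => x; rewrite !inE.
  move=> x y /eqP <-; rewrite !inE; congr (_ == _).
  by rewrite order_id_cycle // cycle_orbit.
by rewrite PoszM modzMl mod0z.
Qed.

Lemma Phi1_card_fset_iter_fixed (T : choiceType) (X : {fset T}) (f : T -> T) k :
  (0 < k)%N -> {in X, forall x, f x \in X} -> {in X, forall x, iter k f x = x} ->
  (Phi1 k (fun d => #|` [fset x in X | iter d f x == x]%fset|%:Z) = 0 %[mod k%:Z])%Z.
Proof.
move=> k_gt0 fX fk; pose g (x : X) : X := FSetSub (fX _ (valP x)).
have val_iter d x : val (iter d g x) = iter d f (val x) by elim: d => //= d ->.
have gk x : iter k g x = x by apply: val_inj; rewrite val_iter fk ?(valP x).
have g_inj : injective g.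
  by apply: (can_inj (g := iter k.-1 g)) => x; rewrite -iterSr prednK.
rewrite -(Phi1_card_iter_fixed g_inj k_gt0); congr (modz _ _).
apply: eq_Phi1 => d _; congr Posz.
have -> : [fset x in X | iter d f x == x]%fset =
    [fset val x | x in [pred x : X | iter d g x == x]]%fset.
  apply/fsetP => x; rewrite !inE; apply/andP/imfsetP => /= [[xX dx]|[y /eqP dy ->]].
    by exists (FSetSub xX) => //; apply/eqP/val_inj; rewrite val_iter /= (eqP dx).
  by rewrite -val_iter dy (valP y).
by rewrite card_imfset ?cardE //; apply: val_inj.
Qed.

Lemma Phi1_fixed_points (R : realType) (f : R -> R) n phi :
  (forall x, 1 <= x <= n%:R -> 1 <= f x <= n%:R) ->
  (forall k, (1 <= k)%N -> has_card (fixed_points f k n) (phi k)) ->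
  forall k, (1 <= k)%N -> (Phi1 k phi = 0 %[mod k%:Z])%Z.
Proof.
move=> f_maps card_fix k k_gt0.
have fin d : (0 < d)%N -> finite_set (fixed_points f d n).
  by move=> /card_fix[N XN _]; apply/finite_setP; exists N.
have inP d x : (0 < d)%N ->
    reflect (fixed_points f d n x) (x \in fset_set (fixed_points f d n)).
  move=> d_gt0; rewrite in_fset_set; last exact: fin.
  by apply: (iffP idP) => [/set_mem|/mem_set].
pose X := fset_set (fixed_points f k n).
have fX : {in X, forall x, f x \in X}.
  move=> x /inP[//|xn kx]; apply/inP => //.
  by split; [exact: f_maps | rewrite -iterSr /= kx].
have fk : {in X, forall x, iter k f x = x} by move=> x /inP[].
rewrite -(Phi1_card_fset_iter_fixed k_gt0 fX fk); congr (modz _ _).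
apply: eq_Phi1 => d dk; have d_gt0 := dvdn_gt0 k_gt0 dk.
have [N XN ->] := card_fix d d_gt0; congr Posz; rewrite -(card_fset_set XN).
congr (#|` _|); apply/fsetP => x; rewrite !inE /=.
apply/inP/andP => // [[xn dx]|[/inP[//|xn _] /eqP dx] //].
split; last exact/eqP.
apply/inP => //; split=> //; rewrite -(divnK dk) iterM.
by elim: (k %/ d)%N => //= c ->.
Qed.

(** * Closed walks and weighted cycles *)

Section Walks.
Variables (S : pzSemiRingType) (n : nat) (e : rel 'I_n).

Definition adjacency_mx : 'M[S]_n := \matrix_(i, j) (e i j)%:R.

Lemma adjacency_mx_expE k x y : (adjacency_mx ^+ k) x y =
  \sum_(t : k.-tuple 'I_n) (path e x t && (last x t == y))%:R.
Proof.
elim: k x => [|k IHk] x.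
  by rewrite expr0 mxE (big_pred1 [tuple]) //= => t; apply/esym/eqP/tuple0.
pose consp (q : 'I_n * k.-tuple 'I_n) : k.+1.-tuple 'I_n := [tuple of q.1 :: q.2].
rewrite (reindex consp); last first.
  exists (fun t => (thead t, [tuple of behead t])) => [[z t] _|t _] /=.
    by congr (_, _); apply: val_inj.
  by rewrite /consp /= [RHS]tuple_eta.
rewrite exprS mxE -(pair_bigA _ (fun z t =>
  (path e x (consp (z, t)) && (last x (consp (z, t)) == y))%:R)) /=.
apply: eq_bigr => z _; rewrite mxE IHk big_distrr /=; apply: eq_bigr => t _.
by rewrite -natrM mulnb andbA.
Qed.

Lemma mxtrace_adjacency_mx_exp k : (0 < k)%N ->
  \tr (adjacency_mx ^+ k) = #|[pred t : k.-tuple 'I_n | cycle e t]|%:R.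
Proof.
move=> k_gt0; rewrite /mxtrace; under eq_bigr do rewrite adjacency_mx_expE.
rewrite exchange_big /= -sum1_card natr_sum [RHS]big_mkcond /=.
apply: eq_bigr => -[[|z s] k_eq] _ /=; first by rewrite -(eqP k_eq) in k_gt0.
rewrite (bigD1 (last z s)) //= eqxx andbT big1 ?addr0 => [|x].
  by rewrite inE (cycle_path z) /=; case: (_ && _).
by rewrite eq_sym => /negbTE ->; rewrite andbF.
Qed.
End Walks.

Section CyclicMap.
Variables (T : finType) (s : T -> T).
Hypothesis s_cyclic : forall p q, fconnect s p q.

Lemma order_cyclic p : order s p = #|T|.
Proof. by apply: eq_card => q; apply: s_cyclic. Qed.

Lemma orbit_cyclic p : perm_eq (orbit s p) (index_enum T).
Proof.
apply: uniq_perm => [||q]; [exact: orbit_uniq | exact: index_enum_uniq | ].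
by rewrite -fconnect_orbit s_cyclic mem_index_enum.
Qed.

Lemma iter_cyclic p : iter #|T| s p = p.
Proof. by have /(orbitPcycle 2%N 4%N) := s_cyclic (s p) p; rewrite /= order_cyclic. Qed.
End CyclicMap.

Section WeightedCycle.
Variables (R : comNzRingType) (n : nat) (s : 'I_n.+1 -> 'I_n.+1) (loop arc : 'I_n.+1 -> R).
Hypothesis s_cyclic : forall p q, fconnect s p q.

Definition weighted_cycle_mx : 'M[R]_n.+1 :=
  \matrix_(p, q) (loop p *+ (p == q) + arc p *+ (s p == q)).

Let B := weighted_cycle_mx.

Lemma row_weighted_cycle_mx r p (M : 'M[R]_(n.+1, r)) :
  row p (B *m M) = loop p *: row p M + arc p *: row (s p) M.
Proof.
rewrite row_mul.
have -> : row p B = loop p *: delta_mx 0 p + arc p *: delta_mx 0 (s p).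
  by apply/rowP => q; rewrite !mxE !eqxx /= !mulr_natr ![q == _]eq_sym.
by rewrite mulmxDl -!scalemxAl -!rowE.
Qed.

Lemma weighted_cycle_mxM r (M : 'M[R]_(n.+1, r)) p q :
  (B *m M) p q = loop p * M p q + arc p * M (s p) q.
Proof.
by have /rowP/(_ q) := row_weighted_cycle_mx p M; rewrite [LHS]mxE => ->; rewrite !mxE.
Qed.

Lemma mul_delta_horner_traject p k :
  delta_mx 0 p *m horner_mx B (\prod_(q <- traject s p k) ('X - (loop q)%:P)) =
  \prod_(q <- traject s p k) arc q *: delta_mx 0 (iter k s p) :> 'rV[R]_n.+1.
Proof.
elim: k => [|k IHk]; first by rewrite !big_nil rmorph1 mulmx1 scale1r.
rewrite trajectSr !big_rcons rmorphM /= -[_ * horner_mx _ _]/(_ *m _) mulmxA IHk.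
rewrite -scalemxAl rmorphB /= horner_mx_X horner_mx_C mulmxBr -scalemx1.
rewrite -scalemxAr mulmx1 -rowE.
have := row_weighted_cycle_mx (iter k s p) 1%:M; rewrite mulmx1 !row1 => ->.
by rewrite addrAC subrr add0r scalerA.
Qed.

Lemma horner_weighted_cycle_mx :
  horner_mx B (\prod_p ('X - (loop p)%:P)) = (\prod_p arc p)%:M.
Proof.
apply/row_matrixP => p; rewrite rowE -!(perm_big _ (orbit_cyclic s_cyclic p)) /=.
rewrite mul_delta_horner_traject order_cyclic // iter_cyclic //.
by rewrite -scalemx1 linearZ /= row1 /orbit order_cyclic.
Qed.

Lemma weighted_cycle_mx_exp_eq0 k p q : (k < findex s p q)%N -> (B ^+ k) p q = 0.
Proof.
elim: k p => [|k IHk] p k_lt.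
  by rewrite expr0 mxE -(findex_eq0 s) eqn0Ngt k_lt.
have qp : q != p by rewrite eq_sym -(findex_eq0 s); case: findex k_lt.
have step := fconnect_findex (s_cyclic p q) qp.
rewrite exprS weighted_cycle_mxM !IHk ?mulr0 ?addr0 //; last exact: ltnW.
by rewrite -ltnS -step.
Qed.

Lemma weighted_cycle_mx_exp_diag k p : (k <= n)%N -> (B ^+ k) p p = loop p ^+ k.
Proof.
elim: k => [|k IHk] k_le; first by rewrite !expr0 mxE eqxx.
rewrite exprS weighted_cycle_mxM IHk ?[X in _ + _ * X]weighted_cycle_mx_exp_eq0 //.
- by rewrite mulr0 addr0 exprS.
- have /findex_iter : (n < order s (s p))%N by rewrite order_cyclic ?card_ord.
  by have := iter_cyclic s_cyclic p; rewrite -iterSr card_ord => -> ->.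
- exact: ltnW.
Qed.

Lemma mxtrace_weighted_cycle_mx_exp k : (k <= n)%N -> \tr (B ^+ k) = \sum_p loop p ^+ k.
Proof. by move=> kn; apply: eq_bigr => p _; rewrite weighted_cycle_mx_exp_diag. Qed.

Lemma weighted_cycle_mx_const : (forall p, loop p + arc p = 1) ->
  B *m const_mx 1 = const_mx 1 :> 'cV_n.+1.
Proof.
move=> row_sum; apply/matrixP => p j.
by rewrite weighted_cycle_mxM !mxE !mulr1 row_sum.
Qed.
End WeightedCycle.

Lemma weighted_cycle_mx_fixed (R : idomainType) n (s : 'I_n.+1 -> 'I_n.+1)
    (loop arc : 'I_n.+1 -> R) (M : 'M[R]_n.+1) :
  (forall p q, fconnect s p q) -> (forall p, arc p != 0) ->
  (forall p, loop p + arc p = 1) -> weighted_cycle_mx s loop arc *m M = M ->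
  forall p q, row p M = row q M.
Proof.
move=> s_cyclic arc0 row_sum MB p q.
have row_s r : row (s r) M = row r M.
  have : row r M = loop r *: row r M + arc r *: row (s r) M.
    by rewrite -row_weighted_cycle_mx MB.
  rewrite -{1}[row r M]scale1r -(row_sum r) scalerDl => /addrI eq_row.
  apply/rowP => j; apply: (mulfI (arc0 r)).
  by move/rowP/(_ j): eq_row; rewrite !mxE.
by rewrite -(iter_findex (s_cyclic p q)); elim: findex => //= k ->; rewrite row_s.
Qed.

(** * The difference matrix and the covering matrices *)

Section DifferenceMatrix.
Variables (R : pzRingType) (N : nat).

Definition diff_mx : 'M[R]_(N.+1, N.+2) :=
  \matrix_(i, p) ((p == i.+1 :> nat)%:R - (p == i :> nat)%:R).

Definition psum_mx : 'M[R]_(N.+2, N.+1) := \matrix_(p, i) (i < p)%N%:R.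

Lemma row_diff_mx r (M : 'M[R]_(N.+2, r)) i :
  row i (diff_mx *m M) = row (lift ord0 i) M - row (widen_ord (leqnSn N.+1) i) M.
Proof.
rewrite row_mul.
have -> : row i diff_mx = delta_mx 0 (lift ord0 i) - delta_mx 0 (widen_ord (leqnSn N.+1) i).
  by apply/rowP => p; rewrite !mxE eqxx -!val_eqE.
by rewrite mulmxBl -!rowE.
Qed.

Lemma diff_mxM r (M : 'M[R]_(N.+2, r)) i j :
  (diff_mx *m M) i j = M (lift ord0 i) j - M (widen_ord (leqnSn N.+1) i) j.
Proof. by have /rowP/(_ j) := row_diff_mx M i; rewrite [LHS]mxE => ->; rewrite !mxE. Qed.

Lemma sum_diff_mx lo hi p : (lo <= hi <= N.+1)%N ->
  \sum_(i < N.+1) (lo <= i < hi)%N%:R * diff_mx i p =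
  (p == hi :> nat)%:R - (p == lo :> nat)%:R.
Proof.
move=> /andP[lo_hi hi_N]; under eq_bigr do rewrite mxE mulr_natl mulrb.
rewrite -(telescope_sumr (fun i => (p == i :> nat)%:R)) //.
rewrite -big_mkcond (big_nat_widenl lo 0) // (big_nat_widen 0 hi N.+1) // big_mkord.
by apply: eq_bigl => i.
Qed.

Lemma mul_diff_psum_mx : diff_mx *m psum_mx = 1%:M.
Proof.
apply/matrixP => i j; rewrite diff_mxM !mxE /= /bump /= add1n ltnS.
by rewrite -val_eqE; case: ltngtP; rewrite ?subrr ?subr0.
Qed.

Lemma mul_psum_diff_mx : psum_mx *m diff_mx = 1%:M - const_mx 1 *m delta_mx (0 : 'I_1) ord0.
Proof.
apply/matrixP => p q; rewrite !mxE big_ord1 !mxE /= mul1r.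
rewrite -[in RHS](inj_eq val_inj) eq_sym /= -(@sum_diff_mx 0 p); last exact: (ltn_ord p).
by apply: eq_bigr => i _; rewrite mxE.
Qed.
End DifferenceMatrix.

Section DifferenceLift.
Variables (R : comNzRingType) (N : nat) (A : 'M[R]_N.+1) (B : 'M[R]_N.+2).
Let D := diff_mx R N.
Hypothesis AD_DB : A *m D = D *m B.

Lemma horner_diff_lift q : horner_mx A q *m D = D *m horner_mx B q.
Proof.
elim/poly_ind: q => [|q c IHq]; first by rewrite !rmorph0 mul0mx mulmx0.
rewrite !rmorphD !rmorphM /= !horner_mx_X !horner_mx_C mulmxDl mulmxDr.
rewrite -!mulmxE -mulmxA AD_DB !mulmxA IHq.
by rewrite mul_scalar_mx mul_mx_scalar.
Qed.

Lemma mxtrace_diff_lift q : B *m const_mx 1 = const_mx 1 :> 'cV_N.+2 ->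
  \tr (horner_mx A q) = \tr (horner_mx B q) - q.[1].
Proof.
move=> B1; have hornerB1 : horner_mx B q *m const_mx 1 = q.[1] *: const_mx 1 :> 'cV_N.+2.
  elim/poly_ind: q => [|q c IHq]; first by rewrite rmorph0 mul0mx horner0 scale0r.
  rewrite rmorphD rmorphM /= horner_mx_X horner_mx_C mulmxDl -mulmxE -mulmxA B1 IHq.
  by rewrite mul_scalar_mx -scalerDl !hornerE.
rewrite -[horner_mx A q]mulmx1 -(mul_diff_psum_mx R N) mulmxA horner_diff_lift.
rewrite mxtrace_mulC mulmxA mxtrace_mulC mul_psum_diff_mx mulmxBr mulmx1 raddfB /=.
by rewrite mulmxA hornerB1 mxtrace_mulC -scalemxAr mxtraceZ -rowE trace_mx11 !mxE mulr1.
Qed.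

Lemma horner_diff_lift_eq0 q :
  (forall p p', row p (horner_mx B q) = row p' (horner_mx B q)) -> horner_mx A q = 0.
Proof.
move=> rows_eq; rewrite -[LHS]mulmx1 -(mul_diff_psum_mx R N) mulmxA horner_diff_lift.
suff -> : D *m horner_mx B q = 0 by rewrite mul0mx.
apply/row_matrixP => i; rewrite row_diff_mx row0; apply/eqP; rewrite subr_eq0.
exact/eqP/rows_eq.
Qed.
End DifferenceLift.

Definition covers (v : nat -> nat) (i j : nat) : bool :=
  (minn (v i) (v i.+1) <= j < maxn (v i) (v i.+1))%N.

Definition cover_width (v : nat -> nat) (i : nat) : nat :=
  (maxn (v i) (v i.+1) - minn (v i) (v i.+1))%N.

Definition expanding (v : nat -> nat) (i : nat) : bool := (1 < cover_width v i)%N.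

Definition cover_rel (N : nat) (v : nat -> nat) : rel 'I_N.+1 := fun i j => covers v i j.
Arguments cover_rel : clear implicits.

Definition cover_mx (N : nat) (v : nat -> nat) : 'M[int]_N.+1 :=
  adjacency_mx int (cover_rel N v).

Lemma cover_mx_mul_diff N (v : nat -> nat) (i : 'I_N.+1) p :
  (v i <= N.+1)%N -> (v i.+1 <= N.+1)%N ->
  (cover_mx N v *m diff_mx int N) i p =
  (p == maxn (v i) (v i.+1) :> nat)%:R - (p == minn (v i) (v i.+1) :> nat)%:R.
Proof.
move=> vi vi1; rewrite mxE -sum_diff_mx; last by lia.
by apply: eq_bigr => j _; rewrite mxE.
Qed.

Definition a_char_poly (n : nat) : {poly int} :=
  'X^(n.-1) - 'X^(n.-2) *+ 3 + \sum_(i < n.-2) 'X^i.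

Lemma a_char_poly_factor n :
  ('X - 1) * a_char_poly n.+2 = 'X^n * ('X - 2%:P) ^+ 2 - 1.
Proof.
rewrite /a_char_poly /= mulrDr -subrX1 !exprS.
have -> : (2%:P : {poly int}) = 2 by rewrite rmorph_nat.
by ring.
Qed.

Lemma mxtrace_exp_a r (A : 'M[int]_r.+1) n : (3 <= n)%N ->
  A * horner_mx A (a_char_poly n) = 0 ->
  (forall k, (0 < k < n)%N -> \tr (A ^+ k) = 2 ^+ k.+1 - 1) ->
  forall k, (0 < k)%N -> \tr (A ^+ k) = a n k.
Proof.
case: n => [|[|[|n]]] // _ A_root A_init; apply: a_unique => // k nk.
have : A ^+ (k - n.+2) * horner_mx A (a_char_poly n.+3) = 0.
  by rewrite (_ : (k - n.+2)%N = (k - n.+3).+1) ?exprSr -?mulrA ?A_root ?mulr0 //; lia.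
rewrite rmorphD rmorphB rmorphMn rmorph_sum /= !rmorphXn /= horner_mx_X.
rewrite mulrDr mulrBr mulrnAr mulr_sumr -!exprD => /(congr1 mxtrace).
rewrite mxtrace0 raddfD raddfB raddfMn raddf_sum /=.
have -> : (k - n.+2 + n.+2)%N = k by lia.
have -> : (k - n.+2 + n.+1)%N = k.-1 by lia.
have -> : \sum_(i < n.+1) \tr (A ^+ (k - n.+2) * horner_mx A 'X^i) =
    \sum_(2 <= i < n.+3) \tr (A ^+ (k - i)).
  rewrite [RHS]big_nat_rev /= !big_add1 /= big_mkord; apply: eq_bigr => i _.
  by rewrite rmorphXn /= horner_mx_X -exprD; congr (\tr (A ^+ _)); have := ltn_ord i; lia.
by lra.
Qed.

Definition is_end (N p : nat) : bool := (p == 0%N) || (p == N.+1).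

Lemma big_is_end (T : Type) (idx : T) (op : Monoid.law idx) N (F : bool -> T) :
  \big[op/idx]_(p < N.+2) F (is_end N p) =
  op (F true) (op (\big[op/idx]_(p < N) F false) (F true)).
Proof.
rewrite big_ord_recl big_ord_recr /= /is_end /bump /= !add1n eqxx.
congr (op _ (op _ _)); apply: eq_bigr => p _; rewrite add1n.
by rewrite eqSS ltn_eqF.
Qed.

(* Points are numbered from 0: [fmn_val N m p] is f_{m, N + 2}(p + 1) - 1. *)
Definition fmn_val (N m p : nat) : nat :=
  if p == 0%N then m else if (p < m)%N then p.-1
  else if (p < N.+1)%N then p.+1 else m.-1.

Section FmnTrace.
Variables (N m : nat).
Hypothesis m_bnd : (1 < m <= N)%N.
Let v := fmn_val N m.

Lemma fmn_val_lt p : (p < N.+2)%N -> (v p < N.+2)%N.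
Proof. by rewrite /v /fmn_val; do ![case: ifP => ?]; lia. Qed.

Lemma fmn_val_reach p q : (p < N.+2)%N -> (q < N.+2)%N -> exists k, iter k v p = q.
Proof.
move=> pN qN; pose reach i j := exists k, iter k v i = j.
have trans i j l : reach i j -> reach j l -> reach i l.
  by move=> [c <-] [d <-]; exists (d + c)%N; rewrite iterD.
have step i j : v i = j -> reach i j by exists 1%N.
have down i j : (i <= j < m)%N -> reach j i.
  elim: j => [|j IHj]; first by rewrite leqn0 => /andP[/eqP-> _]; exists 0%N.
  rewrite leq_eqVlt => /andP[/predU1P[->|ij] jm]; first by exists 0%N.
  apply: (trans _ j) (IHj _); last by lia.
  by apply: step; rewrite /v /fmn_val; do ![case: ifP => ?]; lia.
have up i j : (m <= i)%N -> (i <= j < N.+2)%N -> reach i j.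
  move=> mi; elim: j => [|j IHj]; first by lia.
  rewrite leq_eqVlt => /andP[/predU1P[->|ij] jN]; first by exists 0%N.
  apply: (trans _ j) (IHj _) _; first by lia.
  by apply: step; rewrite /v /fmn_val; do ![case: ifP => ?]; lia.
have top_down i j : (m <= i < N.+2)%N -> (j < m)%N -> reach i j.
  move=> iN jm; apply: (trans _ N.+1); first by apply: up; lia.
  apply: (trans _ m.-1); last by apply: down; lia.
  by apply: step; rewrite /v /fmn_val; do ![case: ifP => ?]; lia.
have to_zero : reach p 0%N.
  by have [pm|mp] := ltnP p m; [apply: down | apply: top_down]; lia.
apply: (trans _ 0%N _ to_zero); apply: (trans _ m); first exact: step.
by have [qm|mq] := ltnP q m; [apply: top_down | apply: up]; lia.
Qed.

Let s (p : 'I_N.+2) : 'I_N.+2 := inord (v p).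
Let loop (p : 'I_N.+2) : int := (is_end N p)%:R *+ 2.
Let arc (p : 'I_N.+2) : int := 1 - loop p.
Let B := weighted_cycle_mx s loop arc.

Let s_cyclic p q : fconnect s p q.
Proof.
have val_iter k : val (iter k s p) = iter k v p.
  by elim: k => //= k <-; rewrite inordK // fmn_val_lt.
have [k kq] := fmn_val_reach (ltn_ord p) (ltn_ord q).
suff -> : q = iter k s p by exact: fconnect_iter.
by apply: val_inj; rewrite val_iter kq.
Qed.

Let B_entry p q : B p q = if is_end N p
  then (q == p :> nat)%:R *+ 2 - (q == v p :> nat)%:R else (q == v p :> nat)%:R.
Proof.
rewrite mxE /arc /loop -!val_eqE /= inordK ?fmn_val_lt // ![_ == val q]eq_sym.
by case: is_end; do !case: eqP.
Qed.

Let cover_mx_fmn_lift : cover_mx N v *m diff_mx int N = diff_mx int N *m B.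
Proof.
apply/matrixP => i q; have iN := ltn_ord i.
rewrite diff_mxM !B_entry cover_mx_mul_diff; [|by apply: fmn_val_lt; lia..].
change (lift ord0 i : nat) with i.+1; change (widen_ord _ i : nat) with (i : nat).
have [i0|i_gt0] := posnP i; last have [iN'|i_lt] := eqVneq (i : nat) N.
- have [v0 v1] : v 0 = m /\ v 1 = 0%N by rewrite /v /fmn_val /= ifT //; lia.
  rewrite i0 v0 v1 maxn0 minn0 /is_end /= (_ : (1 == N.+1) = false); last by lia.
  by rewrite mulr2n; ring.
- have [vN vN1] : v N = N.+1 /\ v N.+1 = m.-1.
    by rewrite /v /fmn_val; do ![case: ifP => ?]; lia.
  rewrite iN' vN vN1 (maxn_idPl _) ?(minn_idPr _); [|lia..].
  rewrite /is_end eqxx orbT (_ : (N == 0) || (N == N.+1) = false); last by lia.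
  by rewrite mulr2n; ring.
have [Ni Ni1] : is_end N i = false /\ is_end N i.+1 = false by rewrite /is_end; lia.
have v_mono : (v i <= v i.+1)%N by rewrite /v /fmn_val; do ![case: ifP => ?]; lia.
by rewrite Ni Ni1 (maxn_idPr v_mono) (minn_idPl v_mono).
Qed.

Lemma prod_fmn_loop : \prod_p ('X - (loop p)%:P) = 'X^N * ('X - 2%:P) ^+ 2.
Proof.
rewrite (big_is_end _ _ (fun b => 'X - (b%:R *+ 2)%:P)) /= subr0 prodr_const card_ord.
by rewrite mulrCA -expr2.
Qed.

Lemma prod_fmn_arc : \prod_p arc p = 1.
Proof. by rewrite (big_is_end _ _ (fun b => 1 - b%:R *+ 2)) /= prodr_const expr1n. Qed.

Lemma sum_fmn_loop k : (0 < k)%N -> \sum_p loop p ^+ k = 2 ^+ k.+1.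
Proof.
move=> k_gt0; rewrite (big_is_end _ _ (fun b => (b%:R *+ 2) ^+ k)) /= sumr_const expr0n.
by rewrite gtn_eqF // mul0rn add0r exprS; ring.
Qed.

Lemma cover_mx_fmn_root : horner_mx (cover_mx N v) (a_char_poly N.+2) = 0.
Proof.
apply: (horner_diff_lift_eq0 cover_mx_fmn_lift).
apply: (weighted_cycle_mx_fixed s_cyclic (loop := loop) (arc := arc)) => [p|p|].
- by rewrite /arc /loop; case: is_end.
- by rewrite /arc addrC subrK.
apply/eqP; rewrite -subr_eq0 -[X in _ - X]mul1mx -mulmxBl.
have -> : weighted_cycle_mx s loop arc - 1%:M = horner_mx B ('X - 1).
  by rewrite rmorphB /= horner_mx_X [horner_mx _ 1]rmorph1.
rewrite mulmxE -rmorphM a_char_poly_factor rmorphB rmorph1 -prod_fmn_loop.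
by rewrite /= (horner_weighted_cycle_mx loop arc s_cyclic) prod_fmn_arc subrr.
Qed.

Lemma mxtrace_cover_mx_fmn k : (0 < k)%N -> \tr (cover_mx N v ^+ k) = a N.+2 k.
Proof.
apply: mxtrace_exp_a => [||{}k k_bnd]; first by lia.
  by rewrite cover_mx_fmn_root mulr0.
have B_const : B *m const_mx 1 = const_mx 1 :> 'cV_N.+2.
  by apply: weighted_cycle_mx_const => p; rewrite /arc addrC subrK.
have := mxtrace_diff_lift cover_mx_fmn_lift 'X^k B_const.
rewrite !rmorphXn /= !horner_mx_X hornerXn expr1n => ->.
by rewrite mxtrace_weighted_cycle_mx_exp ?sum_fmn_loop //; lia.
Qed.
End FmnTrace.

Definition f4_val (p : nat) : nat := nth 0%N [:: 3; 0; 3; 1]%N p.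

Lemma mxtrace_cover_mx_f4 k : (0 < k)%N -> \tr (cover_mx 2 f4_val ^+ k) = a 3 k.
Proof.
apply: mxtrace_exp_a => // [|{}k].
  rewrite rmorphD rmorphB rmorphMn big_ord1 !rmorphXn /= horner_mx_X expr0 expr1.
  rewrite expr2 mulrDr mulrBr mulrnAr mulr1; apply/matrixP => i j.
  rewrite !(mxE, big_ord_recl, big_ord0) /=.
  by case: i => -[|[|[|]]] // ?; case: j => -[|[|[|]]] // ?.
case: k => [|[|[|k]]] // _; rewrite ?expr1 ?expr2 /mxtrace.
  by rewrite !(mxE, big_ord_recl, big_ord0).
by rewrite !(mxE, big_ord_recl, big_ord0).
Qed.
(** * Markov maps *)

Lemma affine_self_map_fixed_point (R : realFieldType) (a b c d : R) : c < 1 ->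
  a <= c * a + d <= b -> a <= c * b + d <= b ->
  exists2 t, a <= t <= b & forall u, (c * u + d == u) = (u == t).
Proof.
move=> c1 a_ab b_ab; have c1_gt0 : 0 < 1 - c by rewrite subr_gt0.
exists (d / (1 - c)); first by rewrite ler_pdivlMr // ler_pdivrMr //; lra.
move=> u; apply/eqP/eqP => [u_fixed|->]; last by field; rewrite gt_eqF.
by apply: (canRL (mulfK _)); [rewrite gt_eqF | lra].
Qed.

Lemma exists_unit_cell (R : realFieldType) (m n : nat) (x : R) :
  (m < n)%N -> m%:R <= x <= n%:R ->
  exists2 j, (m <= j < n)%N & j%:R <= x <= j.+1%:R.
Proof.
elim: n => // n IHn; rewrite ltnS => mn /andP[mx xn].
have [nx|xn'] := leP n%:R x; first by exists n; [lia | rewrite nx].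
have mn' : (m < n)%N by rewrite -(ltr_nat R) (le_lt_trans mx xn').
by have [|j jn jx] := IHn mn'; [rewrite mx ltW | exists j => //; lia].
Qed.

Lemma card_eq_unique_rel (T : Type) (x0 : T) (U : finType) (A : set T) (P : pred U)
    (r : T -> U -> Prop) :
  (forall x, A x -> exists! t, P t /\ r x t) ->
  (forall t, P t -> exists! x, A x /\ r x t) ->
  (A #= `I_#|[pred t | P t]|)%card.
Proof.
move=> uniq_t uniq_x.
have [g gP] : {g & forall t, P t -> A (g t) /\ r (g t) t}.
  apply: (@choice _ _ (fun t x => P t -> A x /\ r x t)) => t.
  have [/uniq_x[x [xt _]]|nPt] := boolP (P t); first by exists x.
  by exists x0.
have g_inj : {in [set t | P t]%classic &, injective g}.
  move=> t u /set_mem Pt /set_mem Pu gtu; have [gA gt] := gP t Pt; have [_ gu] := gP u Pu.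
  have [z [_ z_uniq]] := uniq_t _ gA.
  by rewrite -(z_uniq t) // -(z_uniq u) // gtu.
have -> : A = (g @` [set t | P t])%classic.
  apply/seteqP; split=> [x Ax|_ [t Pt <-]]; last by have [] := gP t Pt.
  have [t [[Pt xt] _]] := uniq_t x Ax; exists t => //.
  have [y [_ y_uniq]] := uniq_x t Pt.
  by rewrite -(y_uniq x) // -(y_uniq (g t)) //; apply: gP.
rewrite (card_eql (inj_card_eq g_inj)).
have -> : [set t | P t]%classic = [set` [fset t | t in P]%fset]%classic.
  apply/seteqP; split=> t /=; first by move=> Pt; apply/imfsetP; exists t.
  by move=> /imfsetP[u Pu ->].
by apply/card_eq_fsetP; rewrite card_imfset ?cardE.
Qed.

Section MarkovMap.
Variables (N : nat) (v : nat -> nat).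
Hypothesis v_lt : forall p, (p < N.+2)%N -> (v p < N.+2)%N.

Lemma covers_lt i j : (i < N.+1)%N -> covers v i j -> (j < N.+1)%N.
Proof. by move=> iN; have := @v_lt i; have := @v_lt i.+1; rewrite /covers; lia. Qed.

Lemma path_covers_lt i w : (i < N.+1)%N -> path (covers v) i w -> all (gtn N.+1) w.
Proof.
elim: w i => //= j w IHw i iN /andP[ij jw]; have jN := covers_lt iN ij.
by rewrite jN (IHw j).
Qed.

Lemma iter_v_lt k p : (p < N.+2)%N -> (iter k v p < N.+2)%N.
Proof. by move=> pN; elim: k => //= k; apply: v_lt. Qed.

Definition closed_walk (k : nat) (w : seq nat) : bool :=
  [&& size w == k, all (gtn N.+1) w & cycle (covers v) w].

Lemma closed_walk_rot t k w : closed_walk k (rot t w) = closed_walk k w.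
Proof. by rewrite /closed_walk size_rot (eq_all_r (mem_rot t w)) rot_cycle. Qed.

Lemma closed_walk_map_val k (t : k.-tuple 'I_N.+1) :
  closed_walk k (map val t) = cycle (cover_rel N v) t.
Proof.
rewrite /closed_walk size_map size_tuple eqxx cycle_map.
suff -> : all (gtn N.+1) (map val t) by [].
by rewrite all_map; apply/allP => i _; apply: ltn_ord.
Qed.

Lemma closed_walk_tuple k w : closed_walk k w -> exists t : k.-tuple 'I_N.+1, map val t = w.
Proof.
move=> /and3P[/eqP wk /allP wN _].
have sz : size (map inord w : seq 'I_N.+1) == k by rewrite size_map wk.
exists (Tuple sz); rewrite /= -map_comp map_id_in // => i /wN iN.
exact: inordK.
Qed.

Variables (R : realType) (f : R -> R).

Definition node (p : nat) : R := p.+1%:R.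

Definition in_cell (i : nat) (x : R) : bool := node i <= x <= node i.+1.

Let dom (x : R) := node 0 <= x <= node N.+1.

Lemma le_node p q : (node p <= node q) = (p <= q)%N.
Proof. by rewrite ler_nat ltnS. Qed.

Lemma nodeS p : node p.+1 = node p + 1.
Proof. by rewrite natr1. Qed.

Lemma in_cell_node i p : in_cell i (node p) = (i <= p <= i.+1)%N.
Proof. by rewrite /in_cell !le_node. Qed.

Lemma in_cell_unique i j x : x \isn't a Num.nat -> in_cell i x -> in_cell j x -> i = j.
Proof.
move=> x_nat; have truncnE l : in_cell l x -> Num.truncn x = l.+1.
  move=> /andP[lx xl]; apply: truncn_def; rewrite lx lt_neqAle xl andbT.
  by apply: contra x_nat => /eqP ->; rewrite natr_nat.
by move=> /truncnE xi /truncnE; rewrite xi => -[].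
Qed.

Lemma in_cell_dom i x : (i < N.+1)%N -> in_cell i x -> dom x.
Proof.
by move=> iN /andP[ix xi]; rewrite /dom (le_trans _ ix) ?(le_trans xi) ?le_node.
Qed.

Lemma dom_in_cell x : dom x -> exists2 i, (i < N.+1)%N & in_cell i x.
Proof.
move=> x_dom; have [//|[//|i] iN ix] := @exists_unit_cell R 1 N.+2 x _ x_dom.
by exists i => //; lia.
Qed.

Hypothesis f_node : forall p, (p < N.+2)%N -> f (node p) = node (v p).
Hypothesis f_linear : forall i, (i < N.+1)%N -> linear_on (node i) (node i.+1) f.
Hypothesis width_gt0 : forall i, (i < N.+1)%N -> (0 < cover_width v i)%N.

Let slope (i : nat) : R := (v i.+1)%:R - (v i)%:R.

Lemma normr_slope i : `|slope i| = (cover_width v i)%:R.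
Proof.
rewrite /slope /cover_width; case: (leqP (v i)) => vi.
  by rewrite natrB // ger0_norm // subr_ge0 ler_nat.
by rewrite distrC natrB ?ger0_norm ?subr_ge0 ?ler_nat // ltnW.
Qed.

Lemma slope_neq0 i : (i < N.+1)%N -> slope i != 0.
Proof. by move=> iN; rewrite -normr_eq0 normr_slope pnatr_eq0 -lt0n width_gt0. Qed.

Lemma markovE i x : (i < N.+1)%N -> in_cell i x ->
  f x = node (v i) + slope i * (x - node i).
Proof.
move=> iN ix; have [c [d cd]] := f_linear iN.
have := f_node (ltnW iN : (i < N.+2)%N); have := f_node (iN : (i.+1 < N.+2)%N).
rewrite !cd ?lexx ?le_node ?leqnSn //= /slope /node -!natr1 => f_right f_left.
have -> : (v i.+1)%:R - (v i)%:R = c by lra.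
by rewrite -f_left; ring.
Qed.

Lemma markov_between i x : (i < N.+1)%N -> in_cell i x ->
  node (minn (v i) (v i.+1)) <= f x <= node (maxn (v i) (v i.+1)).
Proof.
move=> iN ix; rewrite (markovE iN ix); move: ix.
rewrite /in_cell nodeS /slope /minn /maxn /node => /andP[ix xi].
case: ltnP; rewrite -?(ltr_nat R) -?(ler_nat R) -!(natr1 (v _)) => vi;
  by apply/andP; split; nra.
Qed.

Lemma markov_dom x : dom x -> dom (f x).
Proof.
move=> /dom_in_cell[i iN ix]; have /andP[lo hi] := markov_between iN ix.
rewrite /dom (le_trans _ lo) ?(le_trans hi) ?le_node //.
by have := v_lt (ltnW iN : (i < N.+2)%N); have := v_lt (iN : (i.+1 < N.+2)%N); lia.
Qed.

Lemma iter_markov_dom k x : dom x -> dom (iter k f x).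
Proof. by move=> x_dom; elim: k => //= k; apply: markov_dom. Qed.

Lemma iter_markov_node k p : (p < N.+2)%N -> iter k f (node p) = node (iter k v p).
Proof. by move=> pN; elim: k => //= k ->; rewrite f_node // iter_v_lt. Qed.

Lemma dom_natP x : dom x ->
  reflect (exists2 p, (p < N.+2)%N & x = node p) (x \is a Num.nat).
Proof.
move=> x_dom; apply: (iffP natrP) => [[[|p] xp]|[p _ ->]]; last by exists p.+1.
  by move: x_dom; rewrite xp /dom ler_nat.
by exists p => //; move: x_dom; rewrite xp /dom !ler_nat => /andP[].
Qed.

Let branch (i : nat) (t : R) : R := node i + (t - node (v i)) / slope i.

Lemma branch_in_cell i j t : (i < N.+1)%N -> covers v i j -> in_cell j t ->
  in_cell i (branch i t).
Proof.
move=> iN ij /andP[jt tj]; rewrite /in_cell nodeS /branch.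
set y := _ / _.
have y_slope : slope i * y = t - node (v i) by rewrite mulrC divfK ?slope_neq0.
suff /andP[y0 y1] : 0 <= y <= 1 by apply/andP; split; lra.
have := slope_neq0 iN; move: ij jt tj y_slope; rewrite /covers /slope /node.
case: (leqP (v i)) => vi; rewrite -!(ler_nat R) => /andP[];
  move: vi; rewrite -?(ltr_nat R) -?(ler_nat R);
  by rewrite -!(natr1 (v _)) -!(natr1 j.+1) -!(natr1 j) => *; apply/andP; split; nra.
Qed.

Lemma branchP i j t x : (i < N.+1)%N -> covers v i j -> in_cell j t ->
  (in_cell i x && (f x == t)) = (x == branch i t).
Proof.
move=> iN ij jt; apply/andP/eqP => [[ix /eqP <-]|->].
  rewrite /branch (markovE iN ix) addrAC subrr add0r.
  by rewrite mulrAC divff ?slope_neq0 // mul1r subrKC.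
have ib := branch_in_cell iN ij jt; split=> //.
rewrite (markovE iN ib) /branch [node i + _]addrC addrK.
by rewrite mulrC divfK ?slope_neq0 // subrKC.
Qed.

Lemma cover_next i x : (i < N.+1)%N -> in_cell i x ->
  exists2 j, covers v i j & in_cell j (f x).
Proof.
move=> iN ix; have [|[|j] jv jx] := @exists_unit_cell R _ _ (f x) _ (markov_between iN ix).
- by have := width_gt0 iN; rewrite /cover_width; lia.
- by move: jv; rewrite ltn0.
by exists j.
Qed.

Lemma cover_next_unique i j j' x : (i < N.+1)%N -> in_cell i x ->
  (f x \is a Num.nat -> x \is a Num.nat) -> covers v i j -> covers v i j' ->
  in_cell j (f x) -> in_cell j' (f x) -> j = j'.
Proof.
move=> iN ix f_nat ij ij' jx j'x.
have [fx_nat|fx_nat] := boolP (f x \is a Num.nat); last exact: in_cell_unique fx_nat jx j'x.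
have [p pN xp] := dom_natP (in_cell_dom iN ix) (f_nat fx_nat).
move: ij ij' ix jx j'x; rewrite /covers xp f_node // !in_cell_node.
by move=> + + ip; have [->|->] : p = i \/ p = i.+1; lia.
Qed.

Definition follows (w : seq nat) (x : R) : bool := all2 in_cell w (traject f x (size w)).

Lemma follows_cat w1 w2 x :
  follows (w1 ++ w2) x = follows w1 x && follows w2 (iter (size w1) f x).
Proof.
elim: w1 x => [//|i w1 IHw] x.
by rewrite /= /follows /= [all2 _ _ _]IHw andbA -iterSr.
Qed.

Lemma follows_rot k w x : (k <= size w)%N -> iter (size w) f x = x ->
  follows (rot k w) (iter k f x) = follows w x.
Proof.
move=> kw wx; rewrite -[in RHS](cat_take_drop k w) !follows_cat size_take_min size_drop.
by rewrite -iterD subnK // wx (minn_idPl kw) andbC.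
Qed.

Lemma follows_exists k i x : (i < N.+1)%N -> in_cell i x ->
  exists w, [/\ size w = k, path (covers v) i w & follows (i :: w) x].
Proof.
elim: k i x => [|k IHk] i x iN ix; first by exists [::]; rewrite /follows /= ix.
have [j ij jx] := cover_next iN ix.
have [w [wk jw w_follows]] := IHk j (f x) (covers_lt iN ij) jx.
by exists (j :: w); rewrite /= wk ij /follows /= ix; split.
Qed.

Lemma fixed_points_iter t k x :
  fixed_points f k N.+2 x -> fixed_points f k N.+2 (iter t f x).
Proof.
move=> [x_dom kx]; split; first exact: iter_markov_dom.
by rewrite -iterD addnC iterD kx.
Qed.

Lemma fixed_point_nat k x : (0 < k)%N -> fixed_points f k N.+2 x ->
  f x \is a Num.nat -> x \is a Num.nat.
Proof.
move=> k_gt0 [x_dom kx] /(dom_natP (markov_dom x_dom))[p pN fxp].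
by rewrite -kx -(prednK k_gt0) iterSr fxp iter_markov_node // natr_nat.
Qed.

Lemma follows_unique k i w w' x : (0 < k)%N -> fixed_points f k N.+2 x -> (i < N.+1)%N ->
  size w = size w' -> path (covers v) i w -> path (covers v) i w' ->
  follows (i :: w) x -> follows (i :: w') x -> w = w'.
Proof.
move=> k_gt0; elim: w w' i x => [|j w IHw] [|j' w'] // i x kx iN.
rewrite /follows /= => -[sz] /andP[ij jw] /andP[ij' jw'].
move=> /and3P[ix jx wx] /and3P[_ j'x w'x].
have jj' : j = j' := cover_next_unique iN ix (fixed_point_nat k_gt0 kx) ij ij' jx j'x.
rewrite -{}jj' in jw' j'x *; congr (_ :: _).
apply: (IHw _ j (f x)) => //; rewrite ?/follows /= ?jx //.
- exact: (fixed_points_iter 1 kx).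
- exact: covers_lt ij.
Qed.

Hypothesis v_reach_end : forall p, (p < N.+2)%N -> exists k, is_end N (iter k v p).

Lemma fixed_point_single_cell k x : (0 < k)%N -> fixed_points f k N.+2 x ->
  exists2 t, (t < k)%N & exists2 i, (i < N.+1)%N &
    forall j, (j < N.+1)%N -> in_cell j (iter t f x) = (j == i).
Proof.
move=> k_gt0 [x_dom kx].
have [/(dom_natP x_dom)[p pN xp]|x_nat] := boolP (x \is a Num.nat); last first.
  exists 0%N => //; have [i iN ix] := dom_in_cell x_dom; exists i => // j jN.
  by apply/idP/eqP => [jx|-> //]; apply: in_cell_unique x_nat jx ix.
have [t t_end] := v_reach_end pN; exists (t %% k)%N; first by rewrite ltn_mod.
have -> : iter (t %% k) f x = node (iter t v p).
  rewrite -iter_markov_node // -xp [in RHS](divn_eq t k) addnC iterD iterM.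
  by congr iter; elim: (t %/ k)%N => //= c <-.
case/orP: t_end => /eqP ->; [exists 0%N | exists N] => // j jN; rewrite in_cell_node; lia.
Qed.

Lemma fixed_point_follows_exists k x : (0 < k)%N -> fixed_points f k N.+2 x ->
  exists2 w, closed_walk k w & follows w x.
Proof.
move=> k_gt0 kx; have [t tk [i iN i_only]] := fixed_point_single_cell k_gt0 kx.
have [_ ky] := fixed_points_iter t kx.
have y_in : in_cell i (iter t f x) by rewrite i_only ?eqxx.
have [w [wk iw w_follows]] := follows_exists k iN y_in.
case/lastP: w wk iw w_follows => [k0|w l]; first by rewrite -k0 in k_gt0.
rewrite size_rcons => wk iw; rewrite -rcons_cons -cats1 follows_cat => /andP[iw_follows].
rewrite [size (i :: w)]wk ky {1}/follows /= andbT => y_in_l.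
have /allP wN := path_covers_lt iN iw.
have li : l = i by apply/eqP; rewrite -i_only //; apply: wN; rewrite mem_rcons mem_head.
have w_closed : closed_walk k (i :: w).
  rewrite /closed_walk /= wk eqxx iN -{2}li iw andbT /=.
  by apply/allP => j jw; apply: wN; rewrite mem_rcons inE jw orbT.
exists (rot (k - t) (i :: w)); first by rewrite closed_walk_rot.
have -> : x = iter (k - t) f (iter t f x) by rewrite -iterD subnK ?kx.2 // ltnW.
by rewrite follows_rot ?[size (i :: w)]wk ?leq_subr.
Qed.

Lemma fixed_point_follows_unique k x w w' : (0 < k)%N -> fixed_points f k N.+2 x ->
  closed_walk k w -> closed_walk k w' -> follows w x -> follows w' x -> w = w'.
Proof.
move=> k_gt0 kx wk w'k wx w'x.
have [t tk [i iN i_only]] := fixed_point_single_cell k_gt0 kx.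
have rot_cons u : closed_walk k u -> follows u x ->
    exists u', [/\ rot t u = i :: u', size u' = k.-1, path (covers v) i u' &
                   follows (i :: u') (iter t f x)].
  move=> uk ux; have /and3P[/eqP sz _ _] := uk.
  have rot_follows : follows (rot t u) (iter t f x).
    by rewrite follows_rot ?sz ?kx.2 // ltnW.
  rewrite -(closed_walk_rot t) in uk; case: (rot t u) uk rot_follows => [|j u'] /=.
    by rewrite /closed_walk ltn_eqF.
  move=> /and3P[/eqP sz' /= /andP[jN _]]; rewrite rcons_path => /andP[ju' _] u'y.
  have ji : j = i by apply/eqP; rewrite -i_only //; case/andP: u'y.
  by rewrite ji in ju' u'y *; exists u'; rewrite -sz'; split.
have [u [wE uk iu uy]] := rot_cons w wk wx.
have [u' [w'E u'k iu' u'y]] := rot_cons w' w'k w'x.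
apply: (@rot_inj t); rewrite wE w'E; congr (_ :: _).
by apply: (follows_unique k_gt0 (fixed_points_iter t kx) iN _ iu iu' uy u'y); rewrite uk.
Qed.

Let pullback (w : seq nat) (t : R) : R := foldr branch t w.

Lemma pullback_in_cell w j t : all (gtn N.+1) w -> sorted (covers v) (rcons w j) ->
  in_cell j t -> in_cell (head j w) (pullback w t).
Proof.
elim: w => [//|i w IHw] /= /andP[iN wN] i_path jt.
have ij : covers v i (head j w) by case: (w) i_path => [|l u] /= /andP[].
exact: branch_in_cell iN ij (IHw wN (path_sorted i_path) jt).
Qed.

Lemma pullbackP w j t x : all (gtn N.+1) w -> sorted (covers v) (rcons w j) ->
  in_cell j t -> (follows w x && (iter (size w) f x == t)) = (x == pullback w t).
Proof.
elim: w x => [//|i w IHw] x /= /andP[iN wN] i_path jt.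
have ij : covers v i (head j w) by case: (w) i_path => [|l u] /= /andP[].
have w_path := path_sorted i_path.
rewrite -(branchP _ iN ij (pullback_in_cell wN w_path jt)) -IHw //.
by rewrite /follows /= -andbA -iterSr.
Qed.

Lemma pullback_affine w t :
  pullback w t = (\prod_(i <- w) slope i)^-1 * t + pullback w 0.
Proof.
elim: w => [|i w IHw]; first by rewrite big_nil invr1 mul1r addr0.
by rewrite big_cons invfM /= IHw /branch; ring.
Qed.

Lemma prod_slope_inv_lt1 w : all (gtn N.+1) w -> has (expanding v) w ->
  (\prod_(i <- w) slope i)^-1 < 1.
Proof.
move=> wN w_exp; apply: le_lt_trans (ler_norm _) _.
have prod_gt0 u : all (gtn N.+1) u -> (0 < \prod_(i <- u) cover_width v i)%N.
  by move=> /allP uN; rewrite big_seq; apply: prodn_cond_gt0 => i /uN; apply: width_gt0.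
rewrite normfV normr_prod (eq_bigr _ (fun i _ => normr_slope i)) -natr_prod.
rewrite invf_lt1 ?ltr1n ?ltr0n ?prod_gt0 //.
elim: w wN w_exp => //= i w IHw /andP[iN wN]; rewrite big_cons => /orP[i_exp|/IHw].
  by have := prod_gt0 w wN; rewrite /expanding in i_exp; nia.
by move=> /(_ wN); have := width_gt0 iN; nia.
Qed.

Hypothesis first_expanding : expanding v 0.
Hypothesis last_expanding : expanding v N.

(* Along a walk through non-expanding cells the end points of each cell are sent to end
   points of the next one, hence eventually to an end of the interval. *)
Lemma closed_walk_expanding k w : (0 < k)%N -> closed_walk k w -> has (expanding v) w.
Proof.
move=> k_gt0 /and3P[/eqP wk /allP wN w_cycle]; apply: contraT => /hasPn not_expanding.
have follow t p : (exists2 i, i \in w & (i <= p <= i.+1)%N) ->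
    exists2 i, i \in w & (i <= iter t v p <= i.+1)%N.
  move=> pw; elim: t => //= t [i iw ip]; exists (next w i); first by rewrite mem_next.
  have := not_expanding i iw; have := next_cycle w_cycle iw.
  rewrite /covers /expanding /cover_width.
  by have [->|->] : iter t v p = i \/ iter t v p = i.+1; lia.
have [i iw] : exists i, i \in w.
  by case: (w) wk => [k0|i u _]; [rewrite -k0 in k_gt0 | exists i; apply: mem_head].
have [t t_end] := v_reach_end (ltnW (wN i iw) : (i < N.+2)%N).
have [|j jw j_end] := follow t i; first by exists i; rewrite ?leqnn ?leqnSn.
have /= jN := wN j jw; have := not_expanding j jw.
have [->|->] : j = 0%N \/ j = N; last by rewrite last_expanding.
  by move: t_end; rewrite /is_end; lia.
by rewrite first_expanding.
Qed.

Lemma closed_walk_fixed_point k w : (0 < k)%N -> closed_walk k w ->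
  exists2 x, dom x & forall y, follows w y && (iter k f y == y) = (y == x).
Proof.
move=> k_gt0 w_closed; have w_exp := closed_walk_expanding k_gt0 w_closed.
case/and3P: w_closed => /eqP <- {k k_gt0}; case: w w_exp => // i w w_exp wN w_cycle.
have iN : (i < N.+1)%N by case/andP: wN.
have w_sorted : sorted (covers v) (rcons (i :: w) i) := w_cycle.
have pull_in t : in_cell i t -> in_cell i (pullback (i :: w) t).
  exact: (@pullback_in_cell (i :: w) i).
have [||x ix xP] := @affine_self_map_fixed_point R (node i) (node i.+1) _
    (pullback (i :: w) 0) (prod_slope_inv_lt1 wN w_exp).
- by rewrite -pullback_affine; apply: pull_in; rewrite in_cell_node leqnn leqnSn.
- by rewrite -pullback_affine; apply: pull_in; rewrite in_cell_node leqnn leqnSn.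
exists x => [|y]; first exact: in_cell_dom iN ix.
have [iy|niy] := boolP (in_cell i y).
  by rewrite (pullbackP y wN w_sorted iy) eq_sym pullback_affine xP.
rewrite /follows /= (negbTE niy); apply/esym/negbTE; apply: contra niy => /eqP ->.
exact: ix.
Qed.

Lemma markov_card_fixed_points k : (0 < k)%N ->
  (fixed_points f k N.+2 #=
    `I_#|[pred t : k.-tuple 'I_N.+1 | cycle (cover_rel N v) t]|)%card.
Proof.
move=> k_gt0; pose followed x (t : k.-tuple 'I_N.+1) := follows (map val t) x.
apply: (card_eq_unique_rel (node 0) (r := followed)) => [x kx|t t_cycle].
  have [w wk wx] := fixed_point_follows_exists k_gt0 kx.
  have [t tw] := closed_walk_tuple wk; rewrite -tw in wk wx.
  exists t; split=> [|t' [t'_cycle t'x]]; first by rewrite -closed_walk_map_val.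
  apply/val_inj/(inj_map val_inj); rewrite -closed_walk_map_val in t'_cycle.
  exact: fixed_point_follows_unique kx wk t'_cycle wx t'x.
have t_closed : closed_walk k (map val t) by rewrite closed_walk_map_val.
have [x x_dom xP] := closed_walk_fixed_point k_gt0 t_closed.
have := xP x; rewrite eqxx => /andP[tx /eqP kx].
exists x; split=> // y [[_ ky] ty]; apply/esym/eqP.
by rewrite -xP; apply/andP; split; [exact: ty | exact/eqP].
Qed.

Lemma markov_has_card_fixed_points k : (0 < k)%N ->
  has_card (fixed_points f k N.+2) (\tr (cover_mx N v ^+ k)).
Proof.
move=> k_gt0; eexists; first exact: markov_card_fixed_points.
by rewrite mxtrace_adjacency_mx_exp // natz.
Qed.
End MarkovMap.

Lemma fmn_has_card_fixed_points (R : realType) n m (f : R -> R) :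
  (4 <= n)%N -> (1 < m < n.-1)%N -> is_fmn m n f ->
  forall k, (1 <= k)%N -> has_card (fixed_points f k n) (a n k).
Proof.
case: n => [|[|N]] //= _ m_bnd [_ _ f1 f_low f_high fn f_lin] k k_gt0.
have mN : (1 < m <= N)%N by lia.
rewrite -(mxtrace_cover_mx_fmn mN k_gt0).
apply: markov_has_card_fixed_points => //.
- by move=> p; apply: fmn_val_lt.
- move=> p pN; rewrite /node /fmn_val.
  have [->|p0] := eqVneq p 0%N; first exact: f1.
  case: ltnP => pm; first by rewrite f_low; [congr _%:R|]; lia.
  case: ltnP => pN'; first by rewrite f_high //; lia.
  have -> : p = N.+1 by lia.
  by rewrite fn prednK //; lia.
- by move=> i iN; apply: f_lin.
- by move=> i iN; rewrite /cover_width /fmn_val; do ![case: ifP => ?]; lia.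
- move=> p pN; have [k' kp] := fmn_val_reach mN pN (isT : (0 < N.+2)%N).
  by exists k'; rewrite kp.
- by rewrite /expanding /cover_width /fmn_val /=; do ![case: ifP => ?]; lia.
- by rewrite /expanding /cover_width /fmn_val /=; do ![case: ifP => ?]; lia.
Qed.

Lemma f4_has_card_fixed_points (R : realType) (f : R -> R) : is_f4 f ->
  forall k, (1 <= k)%N -> has_card (fixed_points f k 4) (a 3 k).
Proof.
move=> [_ _ f1 f2 f3 f4 f12 f23 f34] k k_gt0; rewrite -(mxtrace_cover_mx_f4 k_gt0).
apply: markov_has_card_fixed_points => //.
- by case=> [|[|[|[|]]]].
- by case=> [|[|[|[|]]]].
- by case=> [|[|[|]]].
- by case=> [|[|[|]]].
- by case=> [|[|[|[|]]]] // _; [exists 0%N | exists 1%N | exists 1%N | exists 0%N].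
Qed.

Theorem theorem2 (R : realType) :
  ( (forall f : R -> R, is_f4 f ->
       forall k : nat, (1 <= k)%N -> has_card (fixed_points f k 4) (a 3 k))
    /\ (forall n m : nat, (4 <= n)%N -> (1 < m < n.-1)%N ->
          forall f : R -> R, is_fmn m n f ->
          forall k : nat, (1 <= k)%N -> has_card (fixed_points f k n) (a n k))
    /\ (forall n : nat, (3 <= n)%N ->
          forall k : nat, (1 <= k)%N -> (Phi1 k (a n) = 0 %[mod k%:Z])%Z) )
  /\ (forall n : nat, (3 <= n)%N -> gen_fun n = gen_num n / gen_den n).
Proof.
split; last first.
  by move=> n n3; rewrite -(gen_den_mul_gen_fun n3) mulrC mulKr // gen_den_unit.
split; first exact: f4_has_card_fixed_points.
split=> [n m n4 m_bnd f f_mn|n]; first exact: fmn_has_card_fixed_points f_mn.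
rewrite leq_eqVlt => /predU1P[<-|n4].
  have [f f_4] := is_f4_exists R.
  exact: (@Phi1_fixed_points _ _ 4) (f4_maps f_4) (f4_has_card_fixed_points f_4).
have m_bnd : (1 < 2 < n.-1)%N by lia.
have [f f_mn] := is_fmn_exists R n4 m_bnd.
exact: Phi1_fixed_points (fmn_maps f_mn) (fmn_has_card_fixed_points n4 m_bnd f_mn).
Qed.
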